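(* Let $\mathbf f(\mathbf X)$ be a quadratic, strongly connected, clean and feasible monotone system of polynomials in $n$ variables. Let $c_{\min}$ be the smallest nonzero coefficient occurring in $\mathbf f$, and let $\mu_{\min}$ and $\mu_{\max}$ be the minimal and maximal component of the least fixed point $\mu\mathbf f$, respectively. Let $$k_{\mathbf f} = n\cdot \log\left(\frac{\mu_{\max}}{c_{\min}\cdot \mu_{\min}\cdot \min\{\mu_{\min},1\}}\right).$$ Then for every integer $i\ge 0$ the Newton iterate $\boldsymbol\nu^{(\lceil k_{\mathbf f}\rceil + i)}$ has $i$ valid bits of $\mu\mathbf f$.
   Context: A monotone system of polynomials (MSP) is a map $\mathbf f:\mathbb R_{\ge0}^n\to\mathbb R_{\ge0}^n$ each of whose components $f_i(X_1,\dots,X_n)$ is a polynomial with nonnegative real coefficients. It is feasible if $\mathbf y=\mathbf f(\mathbf y)$ for some $\mathbf y\in\mathbb R_{\ge0}^n$; then it has a least nonnegative fixed point $\mu\mathbf f$ (componentwise order), the limit of the Kleene sequence $\mathbf f^k(\mathbf 0)$. A variable $X_i$ is productive if $(\mathbf f^k(\mathbf 0))_i>0$ for some $k$; $\mathbf f$ is clean if all variables are productive. $\mathbf f$ is quadratic if every monomial has degree at most 2. $X_i$ depends directly on $X_k$ if $\partial f_i/\partial X_k$ is not the zero polynomial; $\mathbf f$ is strongly connected if every variable depends on every variable via the reflexive-transitive closure of direct dependence. The Newton operator is $\mathcal N_{\mathbf f}(\mathbf X)=\mathbf X+(\mathrm{Id}-\mathbf f'(\mathbf X))^{-1}(\mathbf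 f(\mathbf X)-\mathbf X)$, where $\mathbf f'$ is the Jacobian matrix, and the Newton sequence is $\boldsymbol\nu^{(k)}=\mathcal N_{\mathbf f}^k(\mathbf 0)$ (for strongly connected clean feasible MSPs the required inverses exist). A vector $\boldsymbol\nu$ has $i$ valid bits of $\mu\mathbf f$ if $|(\mu\mathbf f)_j-\nu_j|/|(\mu\mathbf f)_j|\le 2^{-i}$ for every $1\le j\le n$. Here $\log$ is the logarithm to base 2.
   Formalization: The index ⌈k_f⌉+i is read as max(0,⌈k_f⌉)+i; this differs only for n=1 and constant f=c≥2, where the claim as written is undefined or false (f=2: k_f=−1, so i=0 asks for ν^(−1) and ν^(0)=0 lacks one valid bit). *)

(* Defs.v *)
From mathcomp Require Import all_boot all_order all_algebra.
From mathcomp Require Import mpoly.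
From mathcomp Require Import classical_sets reals exp.

Set Implicit Arguments.
Unset Strict Implicit.
Unset Printing Implicit Defensive.

Import Order.TTheory GRing.Theory Num.Theory.
Local Open Scope ring_scope.

Definition log2 {R : realType} (x : R) : R := ln x / ln 2.

(* The seed [head 0 s] is an entry of [s] whenever [s] is nonempty, so these
   are the true minimum and maximum of a nonempty [s]. *)
Definition seq_min {R : realType} (s : seq R) : R :=
  \big[Num.min/head 0 s]_(x <- s) x.
Definition seq_max {R : realType} (s : seq R) : R :=
  \big[Num.max/head 0 s]_(x <- s) x.

(* max(0, ceil x), as a natural number *)
Definition nat_ceil {R : realType} (x : R) : nat := absz (Num.max 0 (Num.ceil x)).

Definition nonneg_vec {R : realType} {n : nat} (x : 'cV[R]_n) : Prop :=
  forall i, 0 <= x i 0.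

Definition le_vec {R : realType} {n : nat} (x y : 'cV[R]_n) : Prop :=
  forall i, x i 0 <= y i 0.

Definition monotone_system {R : realType} {n : nat}
    (f : 'I_n -> {mpoly R[n]}) : Prop :=
  forall i m, 0 <= (f i)@_m.

Definition quadratic {R : realType} {n : nat}
    (f : 'I_n -> {mpoly R[n]}) : Prop :=
  forall i m, m \in msupp (f i) -> (mdeg m <= 2)%N.

Definition eval_sys {R : realType} {n : nat}
    (f : 'I_n -> {mpoly R[n]}) (x : 'cV[R]_n) : 'cV[R]_n :=
  \col_i (f i).@[fun j => x j 0].

Definition fixed_point {R : realType} {n : nat}
    (f : 'I_n -> {mpoly R[n]}) (y : 'cV[R]_n) : Prop :=
  nonneg_vec y /\ y = eval_sys f y.

Definition feasible {R : realType} {n : nat}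
    (f : 'I_n -> {mpoly R[n]}) : Prop :=
  exists y : 'cV[R]_n, fixed_point f y.

Definition least_fixed_point {R : realType} {n : nat}
    (f : 'I_n -> {mpoly R[n]}) (y : 'cV[R]_n) : Prop :=
  fixed_point f y /\ forall z, fixed_point f z -> le_vec y z.

(* The least nonnegative fixed point; by convention 0 if there is none, which
   does not happen for a feasible monotone system. *)
Definition mu {R : realType} {n : nat}
    (f : 'I_n -> {mpoly R[n]}) : 'cV[R]_n :=
  xget 0 [set y | least_fixed_point f y]%classic.

Definition productive {R : realType} {n : nat}
    (f : 'I_n -> {mpoly R[n]}) (i : 'I_n) : Prop :=
  exists k : nat, 0 < iter k (eval_sys f) 0 i 0.

Definition clean {R : realType} {n : nat}
    (f : 'I_n -> {mpoly R[n]}) : Prop :=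
  forall i, productive f i.

Definition depends_directly {R : realType} {n : nat}
    (f : 'I_n -> {mpoly R[n]}) : rel 'I_n :=
  fun i k => (f i)^`M(k) != 0.

Definition strongly_connected {R : realType} {n : nat}
    (f : 'I_n -> {mpoly R[n]}) : Prop :=
  forall i j, connect (depends_directly f) i j.

Definition jacobian {R : realType} {n : nat}
    (f : 'I_n -> {mpoly R[n]}) (x : 'cV[R]_n) : 'M[R]_n :=
  \matrix_(i, j) ((f i)^`M(j)).@[fun k => x k 0].

Definition newton_op {R : realType} {n : nat}
    (f : 'I_n -> {mpoly R[n]}) (x : 'cV[R]_n) : 'cV[R]_n :=
  x + invmx (1%:M - jacobian f x) *m (eval_sys f x - x).

Definition newton_seq {R : realType} {n : nat}
    (f : 'I_n -> {mpoly R[n]}) (k : nat) : 'cV[R]_n :=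
  iter k (newton_op f) 0.

Definition valid_bits {R : realType} {n : nat}
    (f : 'I_n -> {mpoly R[n]}) (nu : 'cV[R]_n) (i : nat) : Prop :=
  forall j, `|mu f j 0 - nu j 0| / `|mu f j 0| <= 2 ^- i.

(* [msupp p] lists exactly the monomials whose coefficient in [p] is nonzero. *)
Definition c_min {R : realType} {n : nat} (f : 'I_n -> {mpoly R[n]}) : R :=
  seq_min [seq (f i)@_m | i <- enum 'I_n, m <- msupp (f i)].

Definition mu_min {R : realType} {n : nat} (f : 'I_n -> {mpoly R[n]}) : R :=
  seq_min [seq mu f i 0 | i <- enum 'I_n].

Definition mu_max {R : realType} {n : nat} (f : 'I_n -> {mpoly R[n]}) : R :=
  seq_max [seq mu f i 0 | i <- enum 'I_n].

Definition newton_threshold {R : realType} {n : nat}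
    (f : 'I_n -> {mpoly R[n]}) : R :=
  n%:R * log2 (mu_max f / (c_min f * mu_min f * Num.min (mu_min f) 1)).

(* Main.v *)
(* Write A = f'(mu) and let B be the quadratic part of f, so that
   f(x + e) = f(x) + f'(x) e + B(e, e) and f'(x + e) = f'(x) + 2 B(e, .).
   Since mu is the least pre-fixed point, A v >= v forces A v = v for v >= 0,
   and irreducibility of A then yields a cone vector d > 0 with A d <= d.
   With e = mu - x, a Newton step maps the error e to
   (1 - f'(x))^-1 B(e, e), where the inverse is nonnegative.  If e <= t d then
   B(e, e) <= t B(e, d) <= (t / 2) (1 - f'(x)) d, because
   f'(x) d = A d - 2 B(e, d), so the new error is at most (t / 2) d.
   Finally, following paths of the dependency graph bounds the ratios of entries
   of d by (c_min min(mu_min, 1))^-(n - 1), which accounts for the threshold. *)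

Require Import Defs.
From mathcomp Require Import all_boot all_order all_algebra.
From mathcomp Require Import mpoly.
From mathcomp Require Import classical_sets reals exp.
From mathcomp Require Import boolp.
From mathcomp Require Import ring lra.

Set Implicit Arguments.
Unset Strict Implicit.

Import Order.TTheory GRing.Theory Num.Theory.
Local Open Scope ring_scope.

(** * Exact Taylor expansions of polynomials of degree at most two *)

Section Polynomials.

Variables (R : realFieldType) (n : nat).
Implicit Types (p : {mpoly R[n]}) (m : 'X_{1..n}) (x e : 'I_n -> R).

Lemma sum_delta (j : 'I_n) (F : 'I_n -> R) : \sum_k (j == k)%:R * F k = F j.
Proof.
rewrite (bigD1 j) //= eqxx mul1r big1 ?addr0 // => k kj.
by rewrite eq_sym (negbTE kj) mul0r.
Qed.

Lemma mderiv_var (j k : 'I_n) : ('X_j : {mpoly R[n]})^`M(k) = (j == k)%:R%:MP.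
Proof.
rewrite mderivX mnmE; case: eqP => [->|_]; last by rewrite scale0r mpolyC0.
by rewrite -{1}[U_(k)%MM]addm0 addmC addmK mpolyX0 scale1r mpolyC1.
Qed.

Lemma mdeg_le1 m : (mdeg m <= 1)%N -> m = 0%MM \/ exists j, m = U_(j)%MM.
Proof.
case E: (mdeg m) => [|[|//]] _; first by left; apply/eqP; rewrite -mdeg_eq0 E.
by right; move/eqP: E; rewrite mdeg_eq1 => /existsP[j /eqP ->]; exists j.
Qed.

Lemma mdeg_le2 m : (mdeg m <= 2)%N ->
  (mdeg m <= 1)%N \/ exists j k, m = (U_(j) + U_(k))%MM.
Proof.
rewrite leq_eqVlt => /orP[/eqP mE|]; last by left.
have [j mj] : exists j, m j != 0%N.
  apply/existsP; rewrite -negb_forall; apply/negP => /forallP m0.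
  by move: mE; rewrite mdegE big1 // => i _; apply/eqP/m0.
have Um : (U_(j) <= m)%MM by rewrite lep1mP.
have mD := submK Um.
have: mdeg (m - U_(j) + U_(j)) = 2%N by rewrite mD.
rewrite mdegD mdeg1 addn1 => -[/eqP].
by rewrite mdeg_eq1 => /existsP[k /eqP kE]; right; exists k, j; rewrite -kE mD.
Qed.

Lemma taylor1 p x e : (forall m, m \in msupp p -> (mdeg m <= 1)%N) ->
  p.@[fun j => x j + e j] = p.@[x] + \sum_k (p^`M(k))@_0 * e k.
Proof.
move=> dp; pose P q := q.@[fun j => x j + e j]
  = q.@[x] + \sum_k (q^`M(k))@_0 * e k.
have PD q r : P q -> P r -> P (q + r).
  rewrite /P !mevalD => -> ->; rewrite addrACA -big_split /=; congr (_ + _).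
  by apply: eq_bigr => k _; rewrite mderivD mcoeffD mulrDl.
have PZ c q : P q -> P (c *: q).
  rewrite /P !mevalZ => ->; rewrite mulrDr [X in _ + X]mulr_sumr; congr (_ + _).
  by apply: eq_bigr => k _; rewrite mderivZ mcoeffZ mulrA.
rewrite -/(P p) [p]mpolyE big_seq; apply: (big_ind P).
- by rewrite /P !meval0 big1 ?addr0 // => k _; rewrite mderiv0 mcoeff0 mul0r.
- exact: PD.
move=> m /dp/mdeg_le1[->|[j ->]]; apply: PZ; rewrite /P.
  rewrite mpolyX0 !meval1 big1 ?addr0 // => k _.
  by rewrite -mpolyC1 mderivC mcoeff0 mul0r.
rewrite !mevalXU; congr (_ + _); rewrite -[LHS](sum_delta j e).
by apply: eq_bigr => k _; rewrite mderiv_var mcoeffC eqxx mulr1.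
Qed.

(** Both sides are linear in [p], so monomials suffice. Second derivatives are constant here and are
    read off as coefficients of the monomial [0]. *)
Lemma taylor2 p x e : (forall m, m \in msupp p -> (mdeg m <= 2)%N) ->
  p.@[fun j => x j + e j] = p.@[x] + \sum_k (p^`M(k)).@[x] * e k
    + \sum_k (\sum_j (p^`M(j)^`M(k))@_0 / 2%:R * e j) * e k.
Proof.
move=> dp; pose P q := q.@[fun j => x j + e j]
  = q.@[x] + \sum_k (q^`M(k)).@[x] * e k
    + \sum_k (\sum_j (q^`M(j)^`M(k))@_0 / 2%:R * e j) * e k.
have PD q r : P q -> P r -> P (q + r).
  rewrite /P !mevalD => -> ->.
  rewrite [LHS]addrACA; congr (_ + _).
    rewrite addrACA -big_split /=; congr (_ + _).
    by apply: eq_bigr => k _; rewrite mderivD mevalD mulrDl.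
  rewrite -big_split; apply: eq_bigr => k _ /=; rewrite -mulrDl -big_split.
  by congr (_ * _); apply: eq_bigr => j _ /=; rewrite !mderivD mcoeffD !mulrDl.
have PZ c q : P q -> P (c *: q).
  rewrite /P !mevalZ => ->; rewrite !mulrDr; congr (_ + _ + _); rewrite mulr_sumr.
    by apply: eq_bigr => k _; rewrite mderivZ mevalZ mulrA.
  apply: eq_bigr => k _; rewrite mulrA mulr_sumr; congr (_ * _).
  by apply: eq_bigr => j _; rewrite !mderivZ mcoeffZ !mulrA.
have P1 q : (forall m, m \in msupp q -> (mdeg m <= 1)%N) ->
    (forall j k, q^`M(j)^`M(k) = 0) ->
    (forall k, (q^`M(k)).@[x] = (q^`M(k))@_0) -> P q.
  move=> dq q2 q1; rewrite /P (taylor1 x e dq) [X in _ = _ + X]big1 ?addr0.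
    by congr (_ + _); apply: eq_bigr => k _; rewrite q1.
  by move=> k _; rewrite big1 ?mul0r // => j _; rewrite q2 mcoeff0 !mul0r.
rewrite -/(P p) [p]mpolyE big_seq; apply: (big_ind P).
- rewrite /P !meval0 !big1 ?addr0 // => k _.
    by rewrite big1 ?mul0r // => j _; rewrite !mderiv0 mcoeff0 !mul0r.
  by rewrite mderiv0 meval0 mul0r.
- exact: PD.
move=> m /dp/mdeg_le2[dm|[i [j ->]]]; apply: PZ.
  apply: P1 => [m'|j k|k].
  - by rewrite msuppX inE => /eqP ->.
  - case: (mdeg_le1 dm) => [->|[i ->]].
      by rewrite mpolyX0 -mpolyC1 mderivC mderiv0.
    by rewrite mderiv_var mderivC.
  case: (mdeg_le1 dm) => [->|[i ->]].
    by rewrite mpolyX0 -mpolyC1 mderivC meval0 mcoeff0.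
  by rewrite mderiv_var mevalC mcoeffC eqxx mulr1.
(* Two separate deltas also cover the square [i = j]. *)
have D1 k : ('X_[U_(i) + U_(j)] : {mpoly R[n]})^`M(k) =
    (i == k)%:R *: 'X_j + (j == k)%:R *: 'X_i.
  by rewrite mpolyXD mderivM !mderiv_var -!mul_mpolyC [X in _ + X]mulrC.
rewrite /P mpolyXD !mevalM !mevalXU -mpolyXD.
have -> : \sum_k ('X_[U_(i) + U_(j)]^`M(k)).@[x] * e k = x j * e i + x i * e j.
  rewrite -(sum_delta i (fun k => x j * e k)).
  rewrite -(sum_delta j (fun k => x i * e k)) -big_split.
  by apply: eq_bigr => k _; rewrite D1 /= mevalD !mevalZ !mevalXU mulrDl !mulrA.
have -> : \sum_k (\sum_l
    (('X_[U_(i) + U_(j)])^`M(l)^`M(k))@_0 / 2%:R * e l) * e k = e i * e j.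
  transitivity (\sum_k ((j == k)%:R * (e i / 2%:R * e k)
                        + (i == k)%:R * (e j / 2%:R * e k))).
    apply: eq_bigr => k _; rewrite !mulrA -mulrDl; congr (_ * _).
    rewrite -(sum_delta i (fun l => (j == k)%:R * e l / 2%:R)).
    rewrite -(sum_delta j (fun l => (i == k)%:R * e l / 2%:R)) -!big_split /=.
    apply: eq_bigr => l _; rewrite D1 mderivD !mderivZ !mderiv_var.
    rewrite mcoeffD !mcoeffZ !mcoeffC eqxx !mulr1; ring.
  by rewrite big_split /= !sum_delta; field.
ring.
Qed.

Lemma mderiv_coef_ge0 p k : (forall m, 0 <= p@_m) ->
  forall m, 0 <= (p^`M(k))@_m.
Proof. by move=> p0 m; rewrite mcoeff_deriv mulrn_wge0. Qed.

Lemma meval_ge0 p x : (forall m, 0 <= p@_m) -> (forall i, 0 <= x i) ->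
  0 <= p.@[x].
Proof.
move=> p0 x0; rewrite mevalE sumr_ge0 // => m _; rewrite mulr_ge0 //.
by rewrite prodr_ge0 // => i _; rewrite exprn_ge0.
Qed.

Lemma mderiv_mdeg p k d : (forall m, m \in msupp p -> (mdeg m <= d.+1)%N) ->
  forall m, m \in msupp p^`M(k) -> (mdeg m <= d)%N.
Proof.
move=> dp m; rewrite mcoeff_msupp mcoeff_deriv => H.
have /dp : (m + U_(k))%MM \in msupp p.
  by rewrite mcoeff_msupp; apply: contraNneq H => ->; rewrite mul0rn.
by rewrite mdegD mdeg1 addn1.
Qed.

(** Pick a monomial of the derivative: its coefficient is a positive multiple of one of [p], and,
    having degree at most 1, it takes the value 1 or some [x j], both at least [b]. *)
Lemma mderiv_eval_ge p k x c b : (forall m, 0 <= p@_m) ->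
    (forall m, m \in msupp p -> (mdeg m <= 2)%N) ->
    (forall m, m \in msupp p -> c <= p@_m) -> (forall i, b <= x i) ->
    0 <= c -> 0 <= b -> b <= 1 -> p^`M(k) != 0 ->
  c * b <= (p^`M(k)).@[x].
Proof.
move=> p0 dp cp bx c0 b0 b1.
have x0 i : 0 <= x i by apply: le_trans (bx i).
rewrite -msupp_eq0; case E: (msupp p^`M(k)) => [//|m s] _.
have mS : m \in msupp p^`M(k) by rewrite E mem_head.
have dm := mderiv_mdeg dp mS.
rewrite mevalE (bigD1_seq m) ?msupp_uniq //=.
rewrite -[c * b]addr0 lerD //; last first.
  apply: sumr_ge0 => m' _; rewrite mulr_ge0 ?mderiv_coef_ge0 //.
  by rewrite prodr_ge0 // => i _; rewrite exprn_ge0.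
apply: ler_pM => //.
  move: mS; rewrite mcoeff_msupp mcoeff_deriv => H.
  have /cp cm : (m + U_(k))%MM \in msupp p.
    by rewrite mcoeff_msupp; apply: contraNneq H => ->; rewrite mul0rn.
  by apply: le_trans cm _; rewrite mulrS lerDl mulrn_wge0.
case: (mdeg_le1 dm) => [->|[j ->]].
  by rewrite big1 // => i _; rewrite mnm0E expr0.
by rewrite -mevalX mevalXU.
Qed.

End Polynomials.

(** * Propagation of properties along paths *)

Lemma connect_forward (T : finType) (e : rel T) (P : T -> Prop) (x y : T) :
  (forall u v, e u v -> P u -> P v) -> connect e x y -> P x -> P y.
Proof.
move=> eP /connectP[p + ->]; elim: p x => [|z p IH] x //= /andP[xz zp] Px.
by apply: IH zp _; apply: eP xz Px.
Qed.

Lemma connect_backward (T : finType) (e : rel T) (P : T -> Prop) (x y : T) :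
  (forall u v, e u v -> P v -> P u) -> connect e x y -> P y -> P x.
Proof.
move=> eP /connectP[p + ->]; elim: p x => [|z p IH] x //= /andP[xz zp] Py.
by apply: eP xz _; apply: IH zp Py.
Qed.

(** * Nonnegative matrices and nonnegative inverses *)

Section NonnegMatrices.

Variables (R : realType) (n : nat).
Implicit Types (A J : 'M[R]_n) (x y d e v : 'cV[R]_n).

Definition nonneg_mx A : Prop := forall i j, 0 <= A i j.

Definition irreducible_mx A : Prop :=
  forall i j, connect (fun i j => A i j != 0) i j.

(** Equivalent to invertibility with an entrywise nonnegative inverse; this form compares vectors
    without naming the inverse. *)
Definition inverse_nonneg A : Prop :=
  forall x, nonneg_vec (A *m x) -> nonneg_vec x.

Lemma le_vec_sub x y : nonneg_vec (y - x) <-> le_vec x y.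
Proof. by split=> xy i; move: (xy i); rewrite !mxE subr_ge0. Qed.

Lemma add_mxE (m : nat) (X Y : 'M[R]_(n, m)) i j : (X + Y) i j = X i j + Y i j.
Proof. by rewrite mxE. Qed.

Lemma sub_vecE x y i : (x - y) i 0 = x i 0 - y i 0.
Proof. by rewrite !mxE. Qed.

Lemma le_vec_anti x y : le_vec x y -> le_vec y x -> x = y.
Proof.
by move=> xy yx; apply/colP => i; apply/eqP; rewrite eq_le xy yx.
Qed.

Lemma mulmx_ge0 A x : nonneg_mx A -> nonneg_vec x -> nonneg_vec (A *m x).
Proof.
by move=> A0 x0 i; rewrite mxE sumr_ge0 // => j _; rewrite mulr_ge0.
Qed.

Lemma mulmx_le_vec A x y : nonneg_mx A -> le_vec x y ->
  le_vec (A *m x) (A *m y).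
Proof.
move=> A0 /le_vec_sub xy; apply/le_vec_sub; rewrite -mulmxBr.
exact: mulmx_ge0.
Qed.

Lemma mulmx_entry_le A x i j : nonneg_mx A -> nonneg_vec x ->
  A i j * x j 0 <= (A *m x) i 0.
Proof.
move=> A0 x0; rewrite mxE (bigD1 j) //= lerDl sumr_ge0 // => k _.
by rewrite mulr_ge0.
Qed.

Lemma inverse_nonneg_inj A x : inverse_nonneg A -> A *m x = 0 -> x = 0.
Proof.
move=> invA Ax0; apply: le_vec_anti => [i|i]; rewrite mxE.
  rewrite -oppr_ge0 -[- _]/(- x i 0).
  have /(_ i) : nonneg_vec (- x) by apply: invA => k; rewrite mulmxN Ax0 !mxE oppr0.
  by rewrite mxE.
by apply: invA => k; rewrite Ax0 mxE.
Qed.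

Lemma inverse_nonneg_unit A : inverse_nonneg A -> A \in unitmx.
Proof.
move=> invA; rewrite -unitmx_tr -row_free_unit; apply: inj_row_free => v vA.
apply: trmx_inj; rewrite trmx0; apply: (inverse_nonneg_inj invA).
by rewrite -[A]trmxK -trmx_mul vA trmx0.
Qed.

(* The least first-passage solution [D i0 = 1], [D i = (A *m D) i] for
   [i <> i0], obtained as the join of the vectors [v] with [v i0 = 1] and
   [v i <= (A *m v) i]; the bound [(A *m D) i0 <= 1] comes from [Agrow]. *)
Lemma cone_vector A : (0 < n)%N -> nonneg_mx A -> irreducible_mx A ->
    (forall v, nonneg_vec v -> le_vec v (A *m v) -> A *m v = v) ->
  exists2 d : 'cV[R]_n, (forall i, 0 < d i 0) & le_vec (A *m d) d.
Proof.
move=> n0 A0 Airr Agrow; pose i0 := Ordinal n0.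
pose P v := [/\ nonneg_vec v, v i0 0 = 1
  & forall i, i != i0 -> v i 0 <= (A *m v) i 0].
pose G v : 'cV[R]_n := \col_i (if i == i0 then 1 else (A *m v) i 0).
have PA v : P v -> (A *m v) i0 0 <= 1.
  case=> v0 v1 vA; rewrite leNgt; apply/negP => gt1.
  have vAv : le_vec v (A *m v).
    move=> i; have [->|ii0] := eqVneq i i0; last exact: vA.
    by rewrite v1 ltW.
  by move: gt1; rewrite Agrow // v1 ltxx.
have PG v : P v -> P (G v).
  move=> [v0 v1 vA].
  have vG : le_vec v (G v).
    by move=> i; rewrite mxE; case: eqVneq => [->|/vA //]; rewrite v1.
  split=> [i||i ii0]; first by apply: le_trans (vG i).
    by rewrite mxE eqxx.
  by rewrite mxE (negbTE ii0); apply: mulmx_le_vec.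
(* Boundedness travels along edges: [A i k * v k] is at most [(A *m v) i], which is at most 1 for
   [i = i0] and otherwise an entry of [G v], again in [P]. *)
pose bounded j := exists C, forall v, P v -> v j 0 <= C.
have Pbnd j : bounded j.
  apply: (connect_forward (P := bounded) _ (Airr i0 j));
    last by exists 1 => v [_ ->].
  move=> i k Aik [C vC]; exists (Num.max C 1 / A i k) => v Pv.
  have Aik0 : 0 < A i k by rewrite lt_neqAle eq_sym Aik A0.
  rewrite ler_pdivlMr // mulrC le_max.
  have v0 : nonneg_vec v by case: Pv.
  have le1 := mulmx_entry_le i k A0 v0.
  have [ii0|ii0] := eqVneq i i0.
    by rewrite ii0 in le1 *; rewrite (le_trans le1 (PA _ Pv)) orbT.
  have := vC _ (PG _ Pv); rewrite mxE (negbTE ii0) => /(le_trans le1) ->.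
  by [].
have Pdelta : P (\col_i (i == i0)%:R).
  split=> [i||i ii0]; rewrite mxE ?eqxx //.
  by rewrite (negbTE ii0) mulmx_ge0 // => k; rewrite mxE ler0n.
pose S j := [set v j 0 | v in P]%classic.
pose D : 'cV[R]_n := \col_j sup (S j).
have leD v : P v -> le_vec v D.
  move=> Pv j; rewrite mxE; apply: ub_le_sup; last by exists v.
  by have [C vC] := Pbnd j; exists C => _ [w Pw <-]; apply: vC.
have Dle j C : (forall v, P v -> v j 0 <= C) -> D j 0 <= C.
  move=> vC; rewrite mxE; apply: ge_sup; last by move=> _ [w Pw <-]; apply: vC.
  by eexists; exists (\col_i (i == i0)%:R).
have PD : P D.
  split=> [i||i ii0].
  - by have [d0 _ _] := Pdelta; apply: le_trans (d0 i) (leD _ Pdelta i).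
  - apply/eqP; rewrite eq_le Dle => [/=|v [_ -> //]].
    by have [_ <- _] := Pdelta; apply: leD.
  apply: Dle => v Pv; have [_ _ /(_ i ii0) vA] := Pv.
  by apply: le_trans vA _; apply: mulmx_le_vec => //; apply: leD.
have [D0 D1 _] := PD.
have AD : le_vec (A *m D) D.
  move=> i; have [->|ii0] := eqVneq i i0; first by rewrite D1 PA.
  by have := leD _ (PG _ PD) i; rewrite [G D _ _]mxE (negbTE ii0).
exists D => // i.
apply: (connect_backward (P := fun j => 0 < D j 0) _ (Airr i i0));
  last by rewrite D1.
move=> u v Auv Dv; apply: lt_le_trans (AD u).
apply: lt_le_trans (mulmx_entry_le u v A0 D0).
by rewrite mulr_gt0 // lt_neqAle eq_sym Auv A0.
Qed.

(* If [x] had a negative entry, the indices minimising [x i / e i] would form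
   such a set [S]. *)
Lemma inverse_nonneg_crit J e :
    nonneg_mx J -> (forall i, 0 < e i 0) -> le_vec (J *m e) e ->
    (forall (S : pred 'I_n) k, k \in S ->
      (forall i, i \in S -> (J *m e) i 0 = e i 0) ->
      (forall i j, i \in S -> J i j != 0 -> j \in S) -> False) ->
  inverse_nonneg (1%:M - J).
Proof.
move=> J0 e0 Je noS x Jx k; rewrite leNgt; apply/negP => xk.
case: (Order.TotalTheory.arg_minP (fun i => x i 0 / e i 0) (erefl (xpredT k))).
move=> i0 _ rmin; pose r := x i0 0 / e i0 0.
have r0 : r < 0.
  by apply: le_lt_trans (rmin k isT) _; rewrite pmulr_llt0 ?invr_gt0.
have xr i : r * e i 0 <= x i 0 by rewrite -ler_pdivlMr //; apply: rmin.
(* For the minimal ratio [r], this vector is nonnegative and vanishes exactly on [S]. *)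
have y0 : nonneg_vec (x - r *: e) by move=> i; rewrite !mxE subr_ge0.
pose S := [pred i | x i 0 == r * e i 0].
have SJ i : i \in S -> (J *m x) i 0 <= x i 0 /\ x i 0 = r * e i 0.
  rewrite inE => /eqP xi; split=> //.
  suff /le_vec_sub/(_ i) : nonneg_vec (x - J *m x) by [].
  by rewrite -[X in X - _]mul1mx -mulmxBl.
have rJe i : r * e i 0 <= r * (J *m e) i 0 by rewrite ler_nM2l.
have Jy i : (J *m (x - r *: e)) i 0 = (J *m x) i 0 - r * (J *m e) i 0.
  by rewrite mulmxBr -scalemxAr !mxE.
apply: (noS S i0).
- by rewrite inE; apply/eqP; rewrite /r divfK // gt_eqF.
(* On [S], [0 <= J (x - r e) <= r e - r J e]; as [r < 0] and [J e <= e], equality holds. *)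
- move=> i /SJ[xi xE]; apply/eqP; rewrite eq_le (Je i) /= -(ler_nM2l r0).
  have := mulmx_ge0 J0 y0 i; rewrite Jy subr_ge0 => /le_trans; apply.
  by rewrite -xE.
(* On [S] also [J (x - r e) <= 0], so every entry weighted by a nonzero [J i j] vanishes. *)
move=> i j /SJ[xi xE] Jij.
have : J i j * (x - r *: e) j 0 <= 0.
  apply: le_trans (mulmx_entry_le i j J0 y0) _; rewrite Jy subr_le0.
  by apply: le_trans xi _; rewrite xE.
have Jp : 0 < J i j by rewrite lt_neqAle eq_sym Jij J0.
rewrite pmulr_rle0 // !mxE subr_le0 inE => xj.
by rewrite eq_le xj xr.
Qed.

End NonnegMatrices.

(** * Minima and maxima of finite lists *)

Lemma seq_min_le (R : realType) (s : seq R) x : x \in s -> seq_min s <= x.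
Proof.
rewrite /seq_min; move: (head 0 s) => h; elim: s => //= y s IH.
rewrite inE big_cons ge_min => /orP[/eqP ->|/IH ->]; first by rewrite lexx.
by rewrite orbT.
Qed.

Lemma le_seq_max (R : realType) (s : seq R) x : x \in s -> x <= seq_max s.
Proof.
rewrite /seq_max; move: (head 0 s) => h; elim: s => //= y s IH.
rewrite inE big_cons le_max => /orP[/eqP ->|/IH ->]; first by rewrite lexx.
by rewrite orbT.
Qed.

Lemma seq_min_gt0 (R : realType) (s : seq R) : s != [::] ->
  (forall x, x \in s -> 0 < x) -> 0 < seq_min s.
Proof.
move=> s0 sp; rewrite /seq_min big_seq; apply: (big_ind (fun y => 0 < y)) => //.
- by case: s s0 sp => //= x s _; apply; rewrite inE eqxx.
- by move=> x y x0 y0; rewrite lt_min x0.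
Qed.

(** * Monotone quadratic systems and their least fixed point *)

Section Systems.

Variables (R : realType) (n : nat) (f : 'I_n -> {mpoly R[n]}).
Hypotheses (f_ge0 : monotone_system f) (f_quad : quadratic f).
Implicit Types (x y d e v : 'cV[R]_n).

(** The matrix of [B(e, .)], with [B] the symmetric bilinear form of the quadratic part. *)
Definition half_hessian e : 'M[R]_n :=
  \matrix_(i, k) \sum_j ((f i)^`M(j)^`M(k))@_0 / 2%:R * e j 0.

Lemma eval_sysD x e : eval_sys f (x + e) =
  eval_sys f x + jacobian f x *m e + half_hessian e *m e.
Proof.
apply/colP => i; rewrite !mxE.
rewrite (meval_eq (v2 := fun j => x j 0 + e j 0)); last by move=> j; rewrite mxE.
rewrite taylor2; last exact: f_quad.
by congr (_ + _ + _); apply: eq_bigr => k _; rewrite mxE.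
Qed.

Lemma jacobianD x e : jacobian f (x + e) = jacobian f x + half_hessian e *+ 2.
Proof.
apply/matrixP => i k; rewrite mulr2n !mxE.
rewrite (meval_eq (v2 := fun j => x j 0 + e j 0)); last by move=> j; rewrite mxE.
rewrite taylor1; last by apply: mderiv_mdeg; apply: f_quad.
congr (_ + _); rewrite -big_split; apply: eq_bigr => j _ /=.
by rewrite mderiv_comm -mulrDl -splitr.
Qed.

Lemma half_hessian_ge0 e : nonneg_vec e -> nonneg_mx (half_hessian e).
Proof.
move=> e0 i k; rewrite mxE sumr_ge0 // => j _.
rewrite !mulr_ge0 ?invr_ge0 ?ler0n //.
by do 2!apply: mderiv_coef_ge0; apply: f_ge0.
Qed.

Lemma half_hessianZ t e : half_hessian (t *: e) = t *: half_hessian e.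
Proof.
apply/matrixP => i k; rewrite !mxE mulr_sumr; apply: eq_bigr => j _.
by rewrite mxE mulrCA.
Qed.

Lemma jacobian_ge0 x : nonneg_vec x -> nonneg_mx (jacobian f x).
Proof.
move=> x0 i j; rewrite mxE; apply: meval_ge0 => //.
exact: mderiv_coef_ge0.
Qed.

Lemma eval_sys_ge0 x : nonneg_vec x -> nonneg_vec (eval_sys f x).
Proof. by move=> x0 i; rewrite mxE; apply: meval_ge0. Qed.

Lemma eval_sys_le x y : nonneg_vec x -> le_vec x y ->
  le_vec (eval_sys f x) (eval_sys f y).
Proof.
move=> x0 /le_vec_sub e0; apply/le_vec_sub.
rewrite -{1}[y](subrK x) [_ - x + x]addrC eval_sysD addrAC.
rewrite [X in nonneg_vec (X + _)]addrAC subrr add0r => i.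
rewrite mxE addr_ge0 // mulmx_ge0 //; first exact: jacobian_ge0.
exact: half_hessian_ge0.
Qed.

(** Knaster-Tarski: by monotonicity the componentwise infimum [m] of the pre-fixed points is
    pre-fixed, and so is its image, whence equality. *)
Lemma least_prefixed_point : feasible f -> exists m,
  [/\ nonneg_vec m, eval_sys f m = m &
    forall y, nonneg_vec y -> le_vec (eval_sys f y) y -> le_vec m y].
Proof.
move=> [z [z0 zE]].
pose P y := nonneg_vec y /\ le_vec (eval_sys f y) y.
have Pz : P z by split=> // i; rewrite -zE.
pose S j := [set y j 0 | y in P]%classic.
pose m : 'cV[R]_n := \col_j inf (S j).
have m_le y : P y -> le_vec m y.
  move=> Py j; rewrite mxE; apply: ge_inf; last by exists y.
  by exists 0 => _ [w [w0 _] <-]; apply: w0.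
have le_m j C : (forall y, P y -> C <= y j 0) -> C <= m j 0.
  move=> yC; rewrite mxE; apply: lb_le_inf; last by move=> _ [w Pw <-]; apply: yC.
  by eexists; exists z.
have m0 : nonneg_vec m by move=> j; apply: le_m => y [y0 _].
have fm : le_vec (eval_sys f m) m.
  move=> j; apply: le_m => y Py; have [y0 fy] := Py.
  by apply: le_trans (fy j); apply: eval_sys_le => //; apply: m_le.
exists m; split=> //; last by move=> y y0 fy; apply: m_le.
apply: le_vec_anti => //; apply: m_le; split; first exact: eval_sys_ge0.
by apply: eval_sys_le => //; apply: eval_sys_ge0.
Qed.

(** Identifies the chosen [mu f] with that infimum, which extends its minimality from fixed to
    pre-fixed points. *)
Lemma mu_least_prefixed : feasible f ->
  [/\ nonneg_vec (mu f), eval_sys f (mu f) = mu f &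
    forall y, nonneg_vec y -> le_vec (eval_sys f y) y -> le_vec (mu f) y].
Proof.
move=> /least_prefixed_point[m [m0 mE m_le]].
suff -> : mu f = m by [].
have lm : least_fixed_point f m.
  split=> [|z [z0 zE]]; first by split.
  by apply: m_le => // i; rewrite -zE.
have [[mu0 muE] mu_le] : least_fixed_point f (mu f).
  exact: (xgetI (P := [set y | least_fixed_point f y]%classic) 0 lm).
by apply: le_vec_anti; [apply: mu_le; case: lm|apply: m_le => // i; rewrite -muE].
Qed.

Lemma kleene_le_mu k : feasible f ->
  nonneg_vec (iter k (eval_sys f) 0) /\ le_vec (iter k (eval_sys f) 0) (mu f).
Proof.
move=> /mu_least_prefixed[mu0 muE _]; elim: k => [|k [k0 kmu]] /=.
  by split=> i; rewrite mxE.
by split; [apply: eval_sys_ge0|rewrite -[X in le_vec _ X]muE; apply: eval_sys_le].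
Qed.

Lemma mu_gt0 : feasible f -> clean f -> forall i, 0 < mu f i 0.
Proof.
move=> feas fc i; have [k ki] := fc i.
by have [_ kmu] := kleene_le_mu k feas; apply: lt_le_trans ki (kmu i).
Qed.

Lemma mu_min_le i : mu_min f <= mu f i 0.
Proof. by apply/seq_min_le/map_f; rewrite mem_enum. Qed.

Lemma mu_max_ge i : mu f i 0 <= mu_max f.
Proof. by apply/le_seq_max/map_f; rewrite mem_enum. Qed.

Lemma mu_min_gt0 : (0 < n)%N -> (forall i, 0 < mu f i 0) -> 0 < mu_min f.
Proof.
move=> n0 mu0; apply: seq_min_gt0 => [|_ /mapP[i _ ->] //].
by rewrite -size_eq0 size_map size_enum_ord -lt0n.
Qed.

Lemma c_min_le i m : m \in msupp (f i) -> c_min f <= (f i)@_m.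
Proof.
by move=> mf; apply: seq_min_le; apply: allpairs_f_dep; rewrite ?mem_enum.
Qed.

Lemma c_min_gt0 i : f i != 0 -> 0 < c_min f.
Proof.
rewrite -msupp_eq0 => fi0; apply: seq_min_gt0.
  case E: (msupp (f i)) fi0 => [//|m s] _; apply/eqP => s0.
  have : (f i)@_m \in [::].
    by rewrite -s0; apply: allpairs_f_dep; rewrite ?mem_enum // E mem_head.
  by [].
move=> _ /allpairsPdep[j [m [_ mf ->]]].
by rewrite lt_neqAle f_ge0 andbT eq_sym -mcoeff_msupp.
Qed.

End Systems.

(** The reciprocal of [1 + \sum_i b i / a i] works, since the sum dominates each ratio. *)
Lemma small_step (R : realFieldType) (n : nat) (a b : 'I_n -> R) :
  (forall i, 0 < a i) -> (forall i, 0 <= b i) ->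
  exists2 t, 0 < t & forall i, t * b i <= a i.
Proof.
move=> a0 b0; pose s := 1 + \sum_i b i / a i.
have r0 i : 0 <= b i / a i by rewrite mulr_ge0 ?invr_ge0 // ltW.
have s0 : 0 < s by rewrite ltr_pwDl // sumr_ge0.
exists s^-1 => [|i]; first by rewrite invr_gt0.
rewrite mulrC ler_pdivrMr // -ler_pdivrMl // mulrC /s (bigD1 i) //=.
by rewrite addrCA lerDl addr_ge0 // sumr_ge0.
Qed.

(** * The Jacobian at and below the least fixed point of a strongly connected system *)

Section StronglyConnected.

Variables (R : realType) (n : nat) (f : 'I_n -> {mpoly R[n]}).
Hypotheses (n_gt0 : (0 < n)%N).
Hypotheses (f_ge0 : monotone_system f) (f_quad : quadratic f).
Hypotheses (f_conn : strongly_connected f) (f_clean : clean f).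
Hypothesis f_feas : feasible f.
Implicit Types (x y d e v : 'cV[R]_n).

(** Lower bound for the entry of [f'(mu)] on an edge of the dependency graph. *)
Let q : R := c_min f * Num.min (mu_min f) 1.

Let mu0 : forall i, 0 < mu f i 0 := mu_gt0 f_ge0 f_quad f_feas f_clean.

Let mu_nonneg : nonneg_vec (mu f).
Proof. by move=> i; apply: ltW. Qed.

Let eval_mu : eval_sys f (mu f) = mu f.
Proof. by have [] := mu_least_prefixed f_ge0 f_quad f_feas. Qed.

Let mu_least y : nonneg_vec y -> le_vec (eval_sys f y) y -> le_vec (mu f) y.
Proof.
by have [_ _ le_mu] := mu_least_prefixed f_ge0 f_quad f_feas; apply: le_mu.
Qed.

Let jac_mu0 : nonneg_mx (jacobian f (mu f)).
Proof. exact: jacobian_ge0. Qed.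

Lemma edge_weight_gt0 : 0 < q.
Proof.
rewrite mulr_gt0 // ?lt_min ?mu_min_gt0 ?ltr01 //.
pose i := Ordinal n_gt0; apply: (c_min_gt0 f_ge0 (i := i)).
apply/eqP => fi0; move: (mu0 i).
by rewrite -eval_mu mxE fi0 meval0 ltxx.
Qed.

Lemma jacobian_mu_ge i k : depends_directly f i k -> q <= jacobian f (mu f) i k.
Proof.
move=> fik; rewrite mxE; have mm := mu_min_gt0 n_gt0 mu0.
apply: mderiv_eval_ge => //.
- exact: f_quad.
- by move=> m; apply: c_min_le.
- by move=> j; rewrite ge_min mu_min_le.
- by rewrite ltW // (c_min_gt0 f_ge0 (i := i)) //; apply: contraNneq fik => ->;
    rewrite mderiv0.
- by rewrite le_min ler01 ltW.
- by rewrite ge_min lexx orbT.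
Qed.

Lemma jacobian_mu_irreducible : irreducible_mx (jacobian f (mu f)).
Proof.
move=> i j; apply: connect_sub (f_conn i j) => u v uv; apply: connect1.
by rewrite gt_eqF // (lt_le_trans edge_weight_gt0) // jacobian_mu_ge.
Qed.

Lemma eval_mu_sub x : eval_sys f x =
  mu f - jacobian f x *m (mu f - x) - half_hessian f (mu f - x) *m (mu f - x).
Proof.
have := eval_sysD f_quad x (mu f - x); rewrite [x + _]addrC subrK eval_mu => muE.
by rewrite {1}muE addrAC addrK addrK.
Qed.

Lemma jacobian_mu_sub x : jacobian f (mu f) =
  jacobian f x + half_hessian f (mu f - x) *+ 2.
Proof. by rewrite -jacobianD // addrC subrK. Qed.

(* Otherwise irreducibility provides [w] with [A *m w > w] in every entry, and
   [mu f - t *: w] is a smaller pre-fixed point for small [t]. *)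
Lemma jacobian_mu_no_growth v : nonneg_vec v ->
  le_vec v (jacobian f (mu f) *m v) -> jacobian f (mu f) *m v = v.
Proof.
set A := jacobian f (mu f) => v0 vA; apply: contrapT => vNA.
have [k vk] : exists k, v k 0 < (A *m v) k 0.
  apply: contrapT => Nk; apply: vNA; apply: le_vec_anti => // i.
  by rewrite leNgt; apply/negP => vi; apply: Nk; exists i.
pose grows j w := [/\ nonneg_vec w, le_vec w (A *m w) & w j 0 < (A *m w) j 0].
have [w wP] : exists w, forall j, grows j (w j).
  apply: (@fin_all_exists _ (fun=> 'cV[R]_n)) => j.
  apply: (connect_backward (P := fun j => exists w, grows j w) _
    (jacobian_mu_irreducible j k)); last by exists v.
  (* Replacing [w] by [A w] carries strict growth from [l] back to [i]. *)
  move=> i l Ail [w [w0 wA wl]]; exists (A *m w); split.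
  - exact: mulmx_ge0.
  - exact: mulmx_le_vec.
  rewrite -subr_gt0.
  have -> : (A *m (A *m w)) i 0 - (A *m w) i 0 = (A *m (A *m w - w)) i 0.
    by rewrite mulmxBr sub_vecE.
  have u0 : nonneg_vec (A *m w - w) by apply/le_vec_sub.
  apply: lt_le_trans (mulmx_entry_le i l jac_mu0 u0).
  apply: mulr_gt0; last by rewrite sub_vecE subr_gt0.
  by rewrite lt_neqAle eq_sym Ail jac_mu0.
(* Each [w j] grows weakly everywhere and strictly at [j], so the sum grows strictly everywhere. *)
pose W := \sum_j w j.
have W0 : nonneg_vec W.
  by move=> i; rewrite summxE sumr_ge0 // => j _; have [+ _ _] := wP j; apply.
have WA i : W i 0 < (A *m W) i 0.
  rewrite mulmx_sumr !summxE (bigD1 i) //= [ltRHS](bigD1 i) //=.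
  apply: ltr_leD; first by have [] := wP i.
  by apply: ler_sum => j _; have [_ + _] := wP j; apply.
pose B := half_hessian f W.
have BW0 : nonneg_vec (B *m W) by apply: mulmx_ge0 => //; apply: half_hessian_ge0.
have [t1 t1p t1W] := small_step mu0 W0.
have [t2 t2p t2W] :=
  small_step (fun i => etrans (subr_gt0 (W i 0) _) (WA i)) BW0.
(* [t1] keeps [mu f - t *: W] nonnegative; [t2] makes the quadratic term at most the linear gain. *)
pose t := Num.min t1 t2.
have tp : 0 < t by rewrite lt_min t1p.
have tW i : t * W i 0 <= mu f i 0.
  by apply: le_trans (t1W i); rewrite ler_wpM2r // ge_min lexx.
have tB i : t * (B *m W) i 0 <= (A *m W) i 0 - W i 0.
  by apply: le_trans (t2W i); rewrite ler_wpM2r // ge_min lexx orbT.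
pose x := mu f - t *: W.
have xE : mu f - x = t *: W by rewrite subKr.
have mux : le_vec (mu f) x.
  (* Here [f(mu - t W) = mu - t A W + t^2 B W <= mu - t W]. *)
  apply: mu_least => i; first by rewrite !mxE subr_ge0.
  have JA : jacobian f x = A - (t *: B) *+ 2.
    by rewrite /A (jacobian_mu_sub x) xE half_hessianZ addrK.
  rewrite eval_mu_sub xE half_hessianZ JA mulr2n.
  have := ler_wpM2l (ltW tp) (tB i).
  rewrite !mulmxBl !mulmxDl -!scalemxAr -!scalemxAl /x.
  move: (A *m W) (B *m W) => a b; rewrite !mxE; nra.
have WE : W = 0.
  apply: le_vec_anti => [i|i]; last by rewrite mxE.
  rewrite [leRHS]mxE; move: (mux i).
  by rewrite /x sub_vecE mxE lerDl oppr_ge0 pmulr_rle0.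
by move: (WA k); rewrite WE mulmx0 ltxx.
Qed.

Lemma half_hessian_mul_ge0 x y : nonneg_vec x -> nonneg_vec y ->
  nonneg_vec (half_hessian f x *m y).
Proof. by move=> x0 y0; apply: mulmx_ge0 => //; apply: half_hessian_ge0. Qed.

(* Rewritten as [J e + B(e, e) <= e] for [e = mu f - x], the inequality
   [x <= f x] makes [e] positive and provides the comparison vector. *)
Lemma below_mu_inverse_nonneg x : nonneg_vec x -> le_vec x (mu f) ->
    le_vec x (eval_sys f x) -> x <> mu f ->
  (forall i, 0 < (mu f - x) i 0) /\ inverse_nonneg (1%:M - jacobian f x).
Proof.
move=> x0 xmu xfx xNmu; set e := mu f - x; set J := jacobian f x.
set B := half_hessian f e; set A := jacobian f (mu f).
have e0 : nonneg_vec e by apply/le_vec_sub.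
have J0 : nonneg_mx J by apply: jacobian_ge0.
have B0 : nonneg_mx B by apply: half_hessian_ge0.
have AE : A = J + B *+ 2 by apply: jacobian_mu_sub.
have AE' i k : A i k = J i k + B i k *+ 2.
  by rewrite AE !mulr2n !add_mxE.
have JBE : J *m e + B *m e = mu f - eval_sys f x.
  by rewrite eval_mu_sub -/e -/B -/J -addrA -opprD subKr.
have JB i : (J *m e) i 0 + (B *m e) i 0 <= e i 0.
  have -> : (J *m e) i 0 + (B *m e) i 0 = (mu f - eval_sys f x) i 0.
    by rewrite -JBE add_mxE.
  by rewrite !sub_vecE lerD2l lerN2.
have Be0 := mulmx_ge0 B0 e0; have Je0 := mulmx_ge0 J0 e0.
have ep i : 0 < e i 0.
  have [k ek] : exists k, 0 < e k 0.
    apply: contrapT => Nk; apply: xNmu; apply: le_vec_anti => // i'.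
    rewrite -subr_le0 -sub_vecE leNgt; apply/negP => ei'.
    by apply: Nk; exists i'.
  apply: (connect_backward (P := fun i => 0 < e i 0) _
    (jacobian_mu_irreducible i k)) => // u v Auv ev.
  (* If [e u = 0], then [J e] and [B e] vanish at [u]; as [e v > 0], both [J u v] and [B u v] are 0,
     contradicting the edge. *)
  rewrite lt_neqAle e0 andbT eq_sym; apply: contraNneq Auv => eu.
  have le_uv (C : 'M[R]_n) : nonneg_mx C -> (C *m e) u 0 <= 0 -> C u v = 0.
    move=> C0 Ceu; apply/eqP; rewrite eq_le C0 andbT -(pmulr_lle0 _ ev).
    exact: le_trans (mulmx_entry_le u v C0 e0) Ceu.
  have := JB u; have := Be0 u; have := Je0 u; rewrite eu => Ju Bu JBu.
  have Juv : J u v = 0 by apply: le_uv => //; lra.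
  have Buv : B u v = 0 by apply: le_uv => //; lra.
  by rewrite -/A AE' Juv Buv mul0rn addr0.
split=> //; apply: (inverse_nonneg_crit (e := e)) => //.
  by move=> i; have := JB i; have := Be0 i; lra.
move=> S k Sk Seq Scl.
have Bi i : i \in S -> (B *m e) i 0 = 0.
  by move=> /Seq Ji; have := JB i; have := Be0 i; rewrite Ji; lra.
(* Since [B e = 0] on [S] and [e > 0], edges of [A] leaving a vertex of [S] are edges of [J], so [S]
   is closed under them. *)
have ST i : i \in S.
  apply: (connect_forward (P := fun i => i \in S) _
    (jacobian_mu_irreducible k i)) => // u v Auv Su.
  apply: (Scl _ _ Su); apply: contraNneq Auv => Juv.
  have : B u v * e v 0 <= 0 by rewrite -(Bi u Su) mulmx_entry_le.
  rewrite pmulr_lle0 // => Buv.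
  have {}Buv : B u v = 0 by apply/eqP; rewrite eq_le Buv B0.
  by rewrite -/A AE' Juv Buv mul0rn addr0.
(* Now [J e + B e = e] everywhere, so [x] is a fixed point and [mu f <= x]. *)
apply: xNmu; apply: le_vec_anti => //; apply: mu_least => // i.
have : (mu f - eval_sys f x) i 0 = e i 0.
  by rewrite -JBE add_mxE Seq // Bi // addr0.
by rewrite !sub_vecE; lra.
Qed.

(** * Invariant and error of the Newton iteration *)

Definition newton_inv x : Prop :=
  [/\ nonneg_vec x, le_vec x (mu f), le_vec x (eval_sys f x)
    & inverse_nonneg (1%:M - jacobian f x)].

Lemma newton_inv0 : newton_inv 0.
Proof.
have z0 : nonneg_vec (0 : 'cV[R]_n) by move=> i; rewrite mxE.
have zmu : le_vec 0 (mu f) by move=> i; rewrite mxE.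
have zf : le_vec 0 (eval_sys f 0) by move=> i; rewrite mxE; apply: eval_sys_ge0.
split=> //; have [|//] := below_mu_inverse_nonneg z0 zmu zf.
by move=> E; have := mu0 (Ordinal n_gt0); rewrite -E mxE ltxx.
Qed.

(** Multiplying by [1 - f'(x)] cancels the linear part of the expansion of [f] at [x] and leaves
    [B(e, e)]. *)
Lemma newton_error x : newton_inv x ->
  (1%:M - jacobian f x) *m (mu f - newton_op f x) =
  half_hessian f (mu f - x) *m (mu f - x).
Proof.
case=> x0 xmu xfx invJ; have Ju := inverse_nonneg_unit invJ.
rewrite /newton_op opprD addrA mulmxBr mulKVmx // mulmxBl mul1mx eval_mu_sub.
move: (half_hessian f _ *m _) (jacobian f _ *m _) => b a.
by apply/colP => i; rewrite !mxE; ring.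
Qed.

(** The step [s] is nonnegative because [x <= f x]; the error identity gives [y <= mu f]; and
    [f(y) - y = B(s, s)] gives [y <= f y]. *)
Lemma newton_invS x : newton_inv x -> newton_inv (newton_op f x).
Proof.
move=> invx; have [x0 xmu xfx invJ] := invx.
have Ju := inverse_nonneg_unit invJ; have nerr := newton_error invx.
have e0 : nonneg_vec (mu f - x) by apply/le_vec_sub.
set y := newton_op f x in nerr *; pose s := y - x.
have Js : (1%:M - jacobian f x) *m s = eval_sys f x - x.
  by rewrite /s /y /newton_op [x + _]addrC addrK mulKVmx.
have s0 : nonneg_vec s by apply: invJ; rewrite Js; apply/le_vec_sub.
have yE : y = x + s by rewrite addrC subrK.
have y0 : nonneg_vec y by move=> i; rewrite yE mxE addr_ge0.
have ymu : le_vec y (mu f).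
  apply/le_vec_sub/invJ; rewrite nerr; exact: half_hessian_mul_ge0.
have yfy : le_vec y (eval_sys f y).
  apply/le_vec_sub; rewrite {1}yE eval_sysD //.
  suff -> : eval_sys f x + jacobian f x *m s = y.
    by rewrite addrC addKr; apply: half_hessian_mul_ge0.
  move/eqP: Js; rewrite mulmxBl mul1mx subr_eq addrAC eq_sym subr_eq => /eqP ->.
  by rewrite yE addrC.
split=> //; have [ymuE|/eqP yNmu] := eqVneq y (mu f); last first.
  by have [] := below_mu_inverse_nonneg y0 ymu yfy yNmu.
(* When [mu f] is reached exactly from [x <> mu f], [B(e, e) = 0] with [e > 0] forces [B(e, .) = 0],
   so [f'(mu) = f'(x)] and the inverse property is inherited. *)
have [xmuE|/eqP xNmu] := eqVneq x (mu f); first by rewrite ymuE -xmuE.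
have [ep _] := below_mu_inverse_nonneg x0 xmu xfx xNmu.
have Be : half_hessian f (mu f - x) *m (mu f - x) = 0.
  by rewrite -nerr ymuE subrr mulmx0.
suff B0 : half_hessian f (mu f - x) = 0.
  by rewrite ymuE (jacobian_mu_sub x) B0 mul0rn addr0.
have Bge := half_hessian_ge0 f_ge0 e0.
apply/matrixP => i j; rewrite [RHS]mxE; apply/eqP.
rewrite eq_le Bge andbT -(pmulr_lle0 _ (ep j)).
by apply: le_trans (mulmx_entry_le i j Bge e0) _; rewrite Be mxE.
Qed.

Lemma newton_inv_seq k : newton_inv (newton_seq f k).
Proof.
by elim: k => [|k IH]; [apply: newton_inv0|apply: newton_invS].
Qed.

(** With [e = mu - x], [(t / 2) (1 - f'(x)) d - B(e, e)] equals [(t / 2) (d - A d) + (t B(e, d) -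
    B(e, e))], a sum of nonnegative vectors. *)
Lemma newton_halving x d t : newton_inv x -> nonneg_vec d ->
    le_vec (jacobian f (mu f) *m d) d -> 0 <= t ->
    le_vec (mu f - x) (t *: d) ->
  le_vec (mu f - newton_op f x) ((t / 2%:R) *: d).
Proof.
move=> invx d0 Ad t0 etd; have [x0 xmu xfx invJ] := invx.
have e0 : nonneg_vec (mu f - x) by apply/le_vec_sub.
apply/le_vec_sub/invJ; rewrite mulmxBr newton_error //.
have JE : jacobian f x = jacobian f (mu f) - half_hessian f (mu f - x) *+ 2.
  by rewrite (jacobian_mu_sub x) addrK.
have Bt := mulmx_le_vec (half_hessian_ge0 f_ge0 e0) etd.
rewrite JE mulr2n -scalemxAr !mulmxBl mul1mx mulmxDl => i.
move: (Bt i) (Ad i); rewrite -scalemxAr.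
move: (half_hessian f _ *m d) (jacobian f _ *m d) (half_hessian f _ *m _).
move=> b a c; rewrite !mxE => Bi Ai.
have : 0 <= t * (d i 0 - a i 0) by rewrite mulr_ge0 // subr_ge0.
by lra.
Qed.

Lemma newton_seq_error d t k : nonneg_vec d ->
    le_vec (jacobian f (mu f) *m d) d -> 0 <= t -> le_vec (mu f) (t *: d) ->
  le_vec (mu f - newton_seq f k) ((t * 2^-k) *: d).
Proof.
move=> d0 Ad t0 mut; elim: k => [|k IH].
  by rewrite expr0 invr1 mulr1 /newton_seq /= subr0.
rewrite exprSr invfM mulrA; apply: newton_halving => //.
  exact: newton_inv_seq.
by rewrite mulr_ge0 // invr_ge0 exprn_ge0 // ler0n.
Qed.

(** * Ratios of the entries of a cone vector *)

(** Each edge costs a factor [q]: [q * d k <= A i k * d k <= (A d) i <= d i]. *)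
Lemma cone_path d i p : nonneg_vec d -> le_vec (jacobian f (mu f) *m d) d ->
  path (depends_directly f) i p -> q ^+ size p * d (last i p) 0 <= d i 0.
Proof.
move=> d0 Ad; elim: p i => [|k p IH] i /=; first by rewrite expr0 mul1r.
move=> /andP[ik kp]; apply: le_trans (Ad i).
apply: le_trans (mulmx_entry_le i k jac_mu0 d0).
rewrite exprS -mulrA; apply: ler_pM => //.
- exact: ltW edge_weight_gt0.
- by rewrite mulr_ge0 // exprn_ge0 // ltW // edge_weight_gt0.
- exact: jacobian_mu_ge.
exact: IH.
Qed.

(** Two distinct vertices lie on a closed walk of positive length, along which
    [q ^+ length * d i <= d i]. *)
Lemma edge_weight_le1 d : (1 < n)%N -> (forall i, 0 < d i 0) ->
  le_vec (jacobian f (mu f) *m d) d -> q <= 1.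
Proof.
move=> n1 dp Ad; have d0 : nonneg_vec d by move=> i; apply: ltW.
pose i := Ordinal n_gt0; pose j := Ordinal n1.
have /connectP[[|k p] ip jE] := f_conn i j; first by [].
have /connectP[p' jp' iE] := f_conn j i.
have := cone_path (i := i) (p := (k :: p) ++ p') d0 Ad.
rewrite cat_path ip last_cat -jE jp' -iE => /(_ isT).
rewrite ger_pMl // expr_le1 //; exact: ltW edge_weight_gt0.
Qed.

(** A path without repeated vertices has at most [n - 1] edges, and [q <= 1] allows raising the
    exponent to that; for [n = 1] the path is empty. *)
Lemma cone_ratio d i j : (forall i, 0 < d i 0) ->
  le_vec (jacobian f (mu f) *m d) d -> q ^+ n.-1 * d j 0 <= d i 0.
Proof.
move=> dp Ad; have d0 : nonneg_vec d by move=> k; apply: ltW.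
have /connectP[p0 ip0 ->] := f_conn i j.
case: (shortenP ip0) => p ip pU _.
apply: le_trans (cone_path d0 Ad ip); rewrite ler_pM2r //.
have sp : (size p <= n.-1)%N.
  rewrite -ltnS prednK // -[X in (_ <= X)%N]card_ord.
  by rewrite -[(size p).+1]/(size (i :: p)) -(card_uniqP pU) max_card.
have [n1|n1] := ltnP 1 n.
  apply: ler_wiXn2l sp; first exact: ltW edge_weight_gt0.
  exact: edge_weight_le1 Ad.
have n0 : n.-1 = 0%N by case: (n) n1 => [|[]].
by move: sp; rewrite n0 leqn0 => /eqP ->.
Qed.

End StronglyConnected.

(** * From the logarithmic threshold to valid bits *)

Lemma expr_le_nat_ceil_log2 (R : realType) (n : nat) (x : R) : 0 < x ->
  x ^+ n <= 2%:R ^+ nat_ceil (n%:R * log2 x).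
Proof.
move=> x0; have l2 : 0 < ln 2%:R :> R by rewrite ln_gt0 // ltr1n.
rewrite -ler_ln ?posrE ?exprn_gt0 // !lnXn //.
rewrite -[ln x *+ n]mulr_natl -[ln _ *+ _]mulr_natl -ler_pdivrMr // -mulrA.
rewrite -/(log2 x); set y := _ * _.
apply: le_trans (ceil_ge y) _; rewrite /nat_ceil pmulrn gez0_abs ?le_max ?lexx //.
by rewrite ler_int le_max lexx orbT.
Qed.

(* When the threshold is negative (possible only for n = 1 and f constant, e.g.
   f = 2, where the ceiling is -1), [nat_ceil] replaces its ceiling by 0, as the
   Newton sequence has no terms of negative index. *)
Theorem theorem3p2 (R : realType) (n : nat) (f : 'I_n -> {mpoly R[n]}) :
  (0 < n)%N ->
  monotone_system f ->
  quadratic f ->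
  strongly_connected f ->
  clean f ->
  feasible f ->
  forall i : nat,
    valid_bits f (newton_seq f (nat_ceil (newton_threshold f) + i)) i.
Proof.
move=> n0 f0 fQ fS fC fF i j; set k := nat_ceil _.
have mup := mu_gt0 f0 fQ fF fC; have mu0 : nonneg_vec (mu f) by move=> l; apply: ltW.
have muj := mup j.
have [d dp Ad] := cone_vector n0 (jacobian_ge0 f0 mu0)
  (jacobian_mu_irreducible n0 f0 fQ fS fC fF)
  (jacobian_mu_no_growth n0 f0 fQ fS fC fF).
have d0 : nonneg_vec d by move=> l; apply: ltW.
have [_ /(_ j) nmu _ _] := newton_inv_seq n0 f0 fQ fS fC fF (k + i).
have two_n0 m : 2%:R ^+ m != 0 :> R by rewrite expf_neq0 // pnatr_eq0.
(* It remains to find a scale [t] with [mu f <= t d] and [t * d j <= 2 ^+ k * mu f j]: the first [k]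
   halvings absorb the scale, the other [i] give the bits. *)
have err t : 0 <= t -> le_vec (mu f) (t *: d) ->
    t * d j 0 <= 2 ^+ k * mu f j 0 ->
    `|mu f j 0 - newton_seq f (k + i) j 0| / `|mu f j 0| <= 2 ^- i.
  move=> t0 mut tk; rewrite !ger0_norm ?subr_ge0 // ler_pdivrMr //.
  have := newton_seq_error n0 f0 fQ fS fC fF (k + i) d0 Ad t0 mut j.
  rewrite sub_vecE [X in _ <= X]mxE => /le_trans; apply.
  rewrite mulrAC ler_pdivrMr ?exprn_gt0 //; apply: le_trans tk _.
  by rewrite exprD mulrAC mulrCA mulVf // mulr1.
(* In dimension one, where [edge_weight_le1] does not apply, [t = mu / d] is exact. *)
have [n1|n1] := leqP n 1.
  apply: (err (mu f j 0 / d j 0)) => [|l|].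
  - by rewrite divr_ge0 // ltW.
  - have -> : l = j.
      apply/val_inj => /=; have := leq_trans (ltn_ord l) n1.
      have := leq_trans (ltn_ord j) n1.
      by rewrite !ltnS !leqn0 => /eqP -> /eqP ->.
    by rewrite mxE divfK // gt_eqF.
  rewrite divfK ?gt_eqF //; apply: ler_peMl; first exact: ltW.
  by rewrite exprn_ege1 // ler1n.
set q := c_min f * Num.min (mu_min f) 1.
have q0 : 0 < q := edge_weight_gt0 n0 f0 fQ fC fF.
have q1 : q <= 1 := edge_weight_le1 n0 f0 fQ fS fC fF n1 dp Ad.
have mm0 := mu_min_gt0 n0 mup; pose r := mu_max f / mu_min f.
have r1 : 1 <= r.
  by rewrite ler_pdivlMr // mul1r (le_trans (mu_min_le f j)) ?mu_max_ge.
have r0 : 0 < r by apply: lt_le_trans r1.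
have M0 : 0 < mu_max f by apply: lt_le_trans muj (mu_max_ge f j).
have qn0 : 0 < q ^+ n.-1 by rewrite exprn_gt0.
(* By [cone_ratio], every entry of [d] is at least [q ^+ n.-1 * d j], so this [t] gives
   [t d >= mu_max f]. *)
apply: (err (mu_max f / (q ^+ n.-1 * d j 0))) => [|l|].
- by rewrite divr_ge0 ?mulr_ge0 // ltW.
- rewrite mxE mulrAC ler_pdivlMr ?mulr_gt0 //; apply: ler_pM => //.
  + by rewrite mulr_ge0 // ltW.
  + exact: mu_max_ge.
  exact: (cone_ratio n0 f0 fQ fS fC fF).
rewrite invfM mulrA divfK ?gt_eqF //.
have XE : mu_max f / (c_min f * mu_min f * Num.min (mu_min f) 1) = r / q.
  by rewrite mulrAC -/q invfM mulrCA mulrC mulrAC.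
have : (r / q) ^+ n <= 2%:R ^+ k.
  rewrite /k /newton_threshold XE; apply: expr_le_nat_ceil_log2.
  by rewrite divr_gt0.
move=> le2; apply: le_trans (_ : (r / q) ^+ n * mu_min f <= _); last first.
  by apply: ler_pM => //; rewrite ?mu_min_le ?ltW // exprn_gt0 // divr_gt0.
have -> : mu_max f = r * mu_min f by rewrite divfK // gt_eqF.
(* [r / q ^+ n.-1 <= (r / q) ^+ n] because [r >= 1] and [q <= 1]. *)
rewrite mulrAC ler_pM2r // expr_div_n; apply: ler_pM.
- exact: ltW.
- by rewrite invr_ge0 ltW.
- by rewrite ler_eXnr.
rewrite lef_pV2 ?posrE ?exprn_gt0 //.
by apply: ler_wiXn2l; rewrite ?leq_pred // ltW.
Qed.
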